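(* Let $0<l<L$ be arbitrary. For the curves $\hat\gamma_n^{\pm}$ and $\check\gamma_n^{\pm}$ defined in the context, it holds that $$\mathcal{W}(\hat\gamma_n^{\pm})=(n+1)^2\,\mathcal{W}(\hat\gamma_0^{+}),\qquad \mathcal{W}(\check\gamma_n^{\pm})=(n+1)^2\,\mathcal{W}(\check\gamma_0^{+}),\qquad \mathcal{W}(\hat\gamma_n^{+})<\mathcal{W}(\check\gamma_n^{+})$$ for every $n\in\mathbb{N}\cup\{0\}$.
   Context: The elastic energy of a smooth planar curve $\gamma$ is $\mathcal{W}(\gamma)=\int_\gamma\kappa^2\,ds$, where $s$ is arc length and $\kappa$ the curvature. Complete elliptic integrals with modulus $p\in[0,1)$: $\mathrm{K}(p)=\int_0^1\frac{dz}{\sqrt{1-z^2}\sqrt{1-p^2z^2}}$ and $\mathrm{E}(p)=\int_0^1\frac{\sqrt{1-p^2z^2}}{\sqrt{1-z^2}}\,dz$. The Jacobi elliptic function is $\mathrm{cn}(x,p)=\cos\phi$, where $\phi=\mathrm{am}(x,p)$ is the inverse function of $x(\phi)=\int_0^\phi\frac{d\theta}{\sqrt{1-p^2\sin^2\theta}}$. Given $0<l<L$, let $\hat p\in(0,1)$ be the unique solution of $2\,\mathrm{E}(p)/\mathrm{K}(p)-1=l/L$ and $\check p\in(0,1)$ the unique solution of $-2\,\mathrm{E}(p)/\mathrm{K}(p)+1=l/L$. For $n\in\mathbb{N}\cup\{0\}$ and $s\in[0,L]$ (arc length parameter) set $\hat\gamma_n^{\pm}(s)=(\hat X_n(s),\pm\hat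 Y_n(s))$, $\check\gamma_n^{\pm}(s)=(\check X_n(s),\pm\check Y_n(s))$, where $$\hat X_n(s)=2\hat p^2\int_0^s \mathrm{cn}\Big(\tfrac{2(n+1)\mathrm{K}(\hat p)}{L}t+\mathrm{K}(\hat p),\hat p\Big)^2dt+(1-2\hat p^2)s,$$ $$\hat Y_n(s)=-\frac{\hat p L}{(n+1)\mathrm{K}(\hat p)}\,\mathrm{cn}\Big(\tfrac{2(n+1)\mathrm{K}(\hat p)}{L}s+\mathrm{K}(\hat p),\hat p\Big),$$ $$\check X_n(s)=-2\check p^2\int_0^s \mathrm{cn}\Big(\tfrac{2(n+1)\mathrm{K}(\check p)}{L}t-\mathrm{K}(\check p),\check p\Big)^2dt-(1-2\check p^2)s,$$ $$\check Y_n(s)=\frac{\check p L}{(n+1)\mathrm{K}(\check p)}\,\mathrm{cn}\Big(\tfrac{2(n+1)\mathrm{K}(\check p)}{L}s-\mathrm{K}(\check p),\check p\Big).$$ *)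

(* Defs.v *)
From Stdlib Require Import Reals.
From Coquelicot Require Import Coquelicot.
Open Scope R_scope.

(** * Elliptic integrals and functions, with modulus [p] in [0, 1) *)

(* The integrands are unbounded at [z = 1], so the integrals are improper
   there. *)
Definition ellK (p : R) : R :=
  RInt_gen (fun z => / (sqrt (1 - z ^ 2) * sqrt (1 - p ^ 2 * z ^ 2)))
           (at_point 0) (at_left 1).

Definition ellE (p : R) : R :=
  RInt_gen (fun z => sqrt (1 - p ^ 2 * z ^ 2) / sqrt (1 - z ^ 2))
           (at_point 0) (at_left 1).

Definition ellF (phi p : R) : R :=
  RInt (fun theta => / sqrt (1 - p ^ 2 * sin theta ^ 2)) 0 phi.

(* For [0 <= p < 1], [fun phi => ellF phi p] is an increasing bijection of the
   real line; [iota] picks the unique [phi] it sends to [x]. *)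
Definition am (x p : R) : R := iota (fun phi : R => ellF phi p = x).

Definition cn (x p : R) : R := cos (am x p).

(** * Elastic energy of a planar curve *)

(* Valid for any regular parametrization, not only by arc length. *)
Definition speed (gamma : R -> R * R) (t : R) : R :=
  let x := fun u => fst (gamma u) in
  let y := fun u => snd (gamma u) in
  sqrt (Derive x t ^ 2 + Derive y t ^ 2).

Definition curvature (gamma : R -> R * R) (t : R) : R :=
  let x := fun u => fst (gamma u) in
  let y := fun u => snd (gamma u) in
  (Derive x t * Derive_n y 2 t - Derive y t * Derive_n x 2 t)
    / speed gamma t ^ 3.

(* The energy of [gamma] restricted to [a, b]; [speed gamma t] is [ds/dt]. *)
Definition elastic_energy (gamma : R -> R * R) (a b : R) : R :=
  RInt (fun t => curvature gamma t ^ 2 * speed gamma t) a b.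

(** * The curves *)

Inductive branch : Set := Plus | Minus.

Definition sgn (e : branch) : R :=
  match e with Plus => 1 | Minus => -1 end.

(* In the following definitions [p] stands for the modulus attached to the
   pair [(l, L)]: [p_hat] for the hat curves, [p_check] for the check ones. *)

Definition hatX (L p : R) (n : nat) (s : R) : R :=
  2 * p ^ 2 *
    RInt (fun t => cn (2 * (INR n + 1) * ellK p / L * t + ellK p) p ^ 2) 0 s
  + (1 - 2 * p ^ 2) * s.

Definition hatY (L p : R) (n : nat) (s : R) : R :=
  - (p * L / ((INR n + 1) * ellK p)) *
    cn (2 * (INR n + 1) * ellK p / L * s + ellK p) p.

Definition checkX (L p : R) (n : nat) (s : R) : R :=
  - 2 * p ^ 2 *
    RInt (fun t => cn (2 * (INR n + 1) * ellK p / L * t - ellK p) p ^ 2) 0 s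
  - (1 - 2 * p ^ 2) * s.

Definition checkY (L p : R) (n : nat) (s : R) : R :=
  p * L / ((INR n + 1) * ellK p) *
    cn (2 * (INR n + 1) * ellK p / L * s - ellK p) p.

Definition gamma_hat (L p : R) (n : nat) (e : branch) (s : R) : R * R :=
  (hatX L p n s, sgn e * hatY L p n s).

Definition gamma_check (L p : R) (n : nat) (e : branch) (s : R) : R * R :=
  (checkX L p n s, sgn e * checkY L p n s).

(* Main.v *)
Require Import Defs.
From Stdlib Require Import Reals Lra.
From Coquelicot Require Import Coquelicot.
Open Scope R_scope.

(** Along each curve write [phi] for the amplitude [am (a * s + c) p], where
    [a = 2 (n + 1) K / L], and [Delta phi = sqrt (1 - p^2 sin^2 phi)], so that
    [phi' = a Delta phi].  Up to signs, the tangent vector is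
    [(1 - 2 p^2 sin^2 phi, 2 p sin phi * Delta phi)], which has length one, and
    differentiating once more gives the curvature [2 p a cos phi]
    ([wavelike_curvature]).  The energy is therefore the integral over [0, L]
    of [4 p^2 a^2 cos^2 phi].  Taking [phi] as the variable turns it into
    [4 p^2 a] times the integral of [cos^2 / Delta], a function which is even
    and of period [PI].  As [s] runs over [0, L], the argument [a * s + c]
    increases by [2 (n + 1) K], hence [phi] by [(n + 1) PI] ([am_shift]),
    whatever the phase [c] is.  So the integral is [2 (n + 1)] times
    [J p], the integral of [cos^2 / Delta] over [0, PI / 2], and in all cases
    the energy equals [(n + 1)^2 * 16 p^2 K(p) J(p) / L] ([wavelike_energy]).

    Both scaling identities are then immediate, and since the two families
    share this formula they are compared through their moduli alone.  [K] and
    [J] are nondecreasing in [p] and [E] is nonincreasing, because their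
    integrands on [0, PI / 2] are; so the energy increases strictly with [p]
    and [E / K] is nonincreasing.  The equations for the moduli say
    [E / K = (1 + l / L) / 2] at [p_hat] and [E / K = (1 - l / L) / 2] at
    [p_check], which is smaller; hence [p_hat < p_check]. *)

(** * Integrals of continuous, even and periodic functions *)

Lemma is_derive_continuous (f : R -> R) (x l : R) : is_derive f x l -> continuous f x.
Proof.
  intros H. apply (ex_derive_continuous (K := R_AbsRing) (V := R_NormedModule)).
  now exists l.
Qed.

Lemma continuous_ex_RInt (f : R -> R) (a b : R) :
  (forall x, continuous f x) -> ex_RInt f a b.
Proof. intros Hf. apply (ex_RInt_continuous (V := R_CompleteNormedModule)). auto. Qed.

Lemma RInt_add (f : R -> R) (a b c : R) :
  (forall x, continuous f x) -> RInt f a b + RInt f b c = RInt f a c.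
Proof.
  intros Hf.
  apply (RInt_Chasles (V := R_CompleteNormedModule)); now apply continuous_ex_RInt.
Qed.

Lemma is_derive_primitive (f : R -> R) (a x : R) :
  (forall y, continuous f y) -> is_derive (fun y => RInt f a y) x (f x).
Proof.
  intros Hf. apply (is_derive_RInt f (fun y => RInt f a y) a x); [|apply Hf].
  apply filter_forall; intros y.
  apply (RInt_correct (V := R_CompleteNormedModule)). now apply continuous_ex_RInt.
Qed.

Lemma RInt_scal_R (f : R -> R) (a b c : R) :
  (forall x, continuous f x) -> RInt (fun x => c * f x) a b = c * RInt f a b.
Proof.
  intros Hf. apply (RInt_scal (V := R_CompleteNormedModule) f a b c).
  now apply continuous_ex_RInt.
Qed.

Lemma RInt_even (f : R -> R) (x : R) :
  (forall y, continuous f y) -> (forall y, f (- y) = f y) ->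
  RInt f 0 (- x) = - RInt f 0 x.
Proof.
  intros Hc He.
  generalize (RInt_comp_lin (V := R_CompleteNormedModule) f (-1) 0 0 x
    (continuous_ex_RInt _ _ _ Hc)).
  replace (-1 * 0 + 0) with 0 by ring. replace (-1 * x + 0) with (- x) by ring.
  intros <-.
  rewrite <- (Rmult_1_l (RInt f 0 x)), <- Ropp_mult_distr_l_reverse, <- RInt_scal_R by easy.
  apply RInt_ext; intros y _. unfold scal; simpl; unfold mult; simpl.
  replace (-1 * y + 0) with (- y) by ring. rewrite He. ring.
Qed.

Lemma RInt_translate_period (f : R -> R) (T a b : R) :
  (forall y, continuous f y) -> (forall y, f (y + T) = f y) ->
  RInt f (a + T) (b + T) = RInt f a b.
Proof.
  intros Hc Hp.
  generalize (RInt_comp_lin (V := R_CompleteNormedModule) f 1 T a b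
    (continuous_ex_RInt _ _ _ Hc)).
  rewrite !Rmult_1_l. intros <-.
  apply RInt_ext; intros y _. unfold scal; simpl; unfold mult; simpl.
  rewrite !Rmult_1_l. apply Hp.
Qed.

(** Over one period, by translation, the integral is the one over
    [[- T / 2, T / 2]], which evenness folds onto [[0, T / 2]]. *)
Lemma RInt_even_periods (f : R -> R) (T a : R) (m : nat) :
  (forall y, continuous f y) -> (forall y, f (- y) = f y) ->
  (forall y, f (y + T) = f y) ->
  RInt f a (a + INR m * T) = 2 * INR m * RInt f 0 (T / 2).
Proof.
  intros Hc He Hp.
  assert (HT : RInt f 0 T = 2 * RInt f 0 (T / 2)).
  { assert (H := RInt_translate_period f T (- (T / 2)) 0 Hc Hp).
    replace (- (T / 2) + T) with (T / 2) in H by field.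
    rewrite Rplus_0_l in H.
    rewrite <- (RInt_add f 0 (T / 2) T Hc), H.
    assert (H1 := RInt_add f 0 (- (T / 2)) 0 Hc).
    rewrite RInt_even in H1 by easy.
    assert (H0 : RInt f 0 0 = 0) by apply (RInt_point (V := R_CompleteNormedModule)).
    lra. }
  assert (H1 : RInt f a (a + T) = RInt f 0 T).
  { assert (H := RInt_translate_period f T 0 a Hc Hp). rewrite Rplus_0_l in H.
    assert (H2 := RInt_add f a T (a + T) Hc). assert (H3 := RInt_add f a 0 T Hc).
    assert (H4 := RInt_add f a 0 a Hc).
    assert (H0 : RInt f a a = 0) by apply (RInt_point (V := R_CompleteNormedModule)).
    lra. }
  induction m as [|m IH].
  - simpl. rewrite Rmult_0_l, Rplus_0_r, Rmult_0_r, Rmult_0_l.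
    apply (RInt_point (V := R_CompleteNormedModule)).
  - rewrite S_INR. rewrite <- (RInt_add f a (a + T)) by easy.
    replace (a + (INR m + 1) * T) with (a + INR m * T + T) by ring.
    rewrite RInt_translate_period by easy. rewrite IH, H1, HT.
    match goal with |- @eq _ ?u ?v => change (@eq R u v) end. ring.
Qed.

(** * Improper integrals with an inverse square root singularity at 1 *)

Lemma is_derive_asin (x : R) : -1 < x < 1 -> is_derive asin x (/ sqrt (1 - x ^ 2)).
Proof.
  intros Hx. apply is_derive_Reals.
  replace (/ sqrt (1 - x ^ 2)) with (derive_pt asin x (derivable_pt_asin x Hx)).
  - apply derive_pt_eq_1 with (derivable_pt_asin x Hx). reflexivity.
  - rewrite derive_pt_asin, Rsqr_pow2.
    unfold Rdiv; ring.
Qed.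

(** The substitution [z = sin t] removes the singularity: the integral up to
    [b < 1] is the integral of a continuous function up to [asin b], which tends
    to [PI / 2].  Continuity of [h o sin] suffices; [h] itself may misbehave
    outside [[-1, 1]], as Legendre's integrands do. *)
Lemma RInt_gen_sin (f h : R -> R) :
  (forall z, f z = h z / sqrt (1 - z ^ 2)) ->
  (forall t, continuous (fun t => h (sin t)) t) ->
  RInt_gen f (at_point 0) (at_left 1) = RInt (fun t => h (sin t)) 0 (PI / 2).
Proof.
  intros Hf Hc.
  apply (is_RInt_gen_unique (V := R_CompleteNormedModule)).
  intros P HP.
  assert (Hcont : continuous (fun y => RInt (fun t => h (sin t)) 0 y) (PI / 2)).
  { apply (ex_derive_continuous (K := R_AbsRing) (V := R_NormedModule)).
    eexists. now apply is_derive_primitive. }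
  destruct (Hcont P HP) as [d Hd].
  assert (HPI := PI_RGT_0).
  (* Cap the modulus of continuity so that [PI / 2 - d'] stays where [sin] is
     increasing. *)
  set (d' := Rmin d (PI / 2)).
  assert (Hd' : 0 < d' /\ d' <= d /\ d' <= PI / 2).
  { split; [|split; [apply Rmin_l|apply Rmin_r]].
    apply Rmin_glb_lt; [apply cond_pos | lra]. }
  set (b0 := sin (PI / 2 - d')).
  assert (Hb0 : b0 < 1).
  { unfold b0. rewrite <- sin_PI2. apply sin_increasing_1; lra. }
  assert (Hb0' : 0 <= b0).
  { apply sin_ge_0; lra. }
  apply Filter_prod with (Q := fun a => a = 0) (R := fun b => b0 < b < 1).
  - reflexivity.
  - exists (mkposreal (1 - b0) (proj2 (Rlt_0_minus _ _) Hb0)). intros y Hy Hy1.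
    unfold ball in Hy; simpl in Hy; unfold AbsRing_ball, abs, minus, plus, opp in Hy; simpl in Hy.
    apply Rabs_def2 in Hy. lra.
  - intros a b -> Hb. simpl.
    exists (RInt (fun t => h (sin t)) 0 (asin b)). split.
    + apply (is_RInt_ext (fun z => scal (/ sqrt (1 - z ^ 2)) (h (sin (asin z))))).
      { intros z Hz. rewrite Rmin_left, Rmax_right in Hz by lra.
        rewrite Hf, sin_asin by lra. unfold scal; simpl; unfold mult; simpl.
        apply Rmult_comm. }
      rewrite <- asin_0 at 2.
      apply (is_RInt_comp (V := R_CompleteNormedModule) (fun t => h (sin t)) asin).
      * intros z _. apply Hc.
      * intros z Hz. rewrite Rmin_left, Rmax_right in Hz by lra. split.
        -- apply is_derive_asin. lra.
        -- apply (ex_derive_continuous (K := R_AbsRing) (V := R_NormedModule)).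
           auto_derive. assert (0 < 1 - z ^ 2) by nra.
           replace (1 + - (z * (z * 1))) with (1 - z ^ 2) by ring.
           split; [easy|]. split; [|easy]. apply Rgt_not_eq. now apply sqrt_lt_R0.
    + apply Hd.
      unfold ball; simpl; unfold AbsRing_ball, abs, minus, plus, opp; simpl.
      assert (Hab := asin_bound b).
      destruct (Rle_lt_dec (asin b) (PI / 2 - d')) as [H|H].
      * exfalso. assert (sin (asin b) <= b0) by (apply sin_incr_1; lra).
        rewrite sin_asin in * by lra. lra.
      * apply Rabs_def1; lra.
Qed.

(** * Legendre's form of the elliptic integrals *)

Definition Delta (p t : R) : R := sqrt (1 - p ^ 2 * sin t ^ 2).

Lemma Delta_arg_pos (p t : R) : 0 < p < 1 -> 0 < 1 - p ^ 2 * sin t ^ 2.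
Proof.
  intros Hp. assert (H := SIN_bound t).
  assert (sin t ^ 2 <= 1) by nra. assert (0 <= sin t ^ 2) by nra.
  assert (p ^ 2 < 1) by nra. nra.
Qed.

Lemma Delta_pos (p t : R) : 0 < p < 1 -> 0 < Delta p t.
Proof. intros Hp. apply sqrt_lt_R0. now apply Delta_arg_pos. Qed.

Lemma Delta_le_1 (p t : R) : 0 < p < 1 -> Delta p t <= 1.
Proof.
  intros Hp. rewrite <- sqrt_1. apply sqrt_le_1_alt.
  assert (0 <= (p * sin t) ^ 2) by apply pow2_ge_0. nra.
Qed.

Lemma Delta_sqr (p t : R) : 0 < p < 1 -> Delta p t ^ 2 = 1 - p ^ 2 * sin t ^ 2.
Proof. intros Hp. apply pow2_sqrt, Rlt_le. now apply Delta_arg_pos. Qed.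

Lemma Delta_opp (p t : R) : Delta p (- t) = Delta p t.
Proof. unfold Delta. rewrite sin_neg. f_equal. ring. Qed.

Lemma Delta_period (p t : R) : Delta p (t + PI) = Delta p t.
Proof. unfold Delta. rewrite neg_sin. f_equal. ring. Qed.

Lemma is_derive_Delta (p t : R) : 0 < p < 1 ->
  is_derive (Delta p) t (- p ^ 2 * sin t * cos t / Delta p t).
Proof.
  intros Hp. unfold Delta. assert (H := Delta_arg_pos p t Hp).
  assert (H1 := Delta_pos p t Hp). unfold Delta in H1.
  auto_derive; replace (1 + - (p * (p * 1) * (sin t * (sin t * 1))))
    with (1 - p ^ 2 * sin t ^ 2) by ring.
  - auto.
  - field. lra.
Qed.

Lemma continuous_Delta (p t : R) : 0 < p < 1 -> continuous (Delta p) t.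
Proof.
  intros Hp. apply (ex_derive_continuous (K := R_AbsRing) (V := R_NormedModule)).
  eexists. now apply is_derive_Delta.
Qed.

Lemma continuous_inv_Delta (p t : R) : 0 < p < 1 -> continuous (fun t => / Delta p t) t.
Proof.
  intros Hp. apply (continuous_comp (Delta p) Rinv).
  - now apply continuous_Delta.
  - apply continuity_pt_filterlim. apply continuity_pt_inv; [apply continuity_pt_id|].
    apply Rgt_not_eq. now apply Delta_pos.
Qed.

Lemma Delta_decreasing (p q t : R) : 0 < p <= q -> q < 1 -> Delta q t <= Delta p t.
Proof.
  intros Hp Hq. apply sqrt_le_1_alt.
  assert (p ^ 2 <= q ^ 2) by nra. assert (0 <= sin t ^ 2) by apply pow2_ge_0. nra.
Qed.

Lemma ellK_Legendre (p : R) : 0 < p < 1 -> ellK p = ellF (PI / 2) p.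
Proof.
  intros Hp. unfold ellK, ellF.
  apply (RInt_gen_sin _ (fun z => / sqrt (1 - p ^ 2 * z ^ 2))).
  - intros z. rewrite Rinv_mult. apply Rmult_comm.
  - intros t. now apply (continuous_inv_Delta p t).
Qed.

Lemma ellE_Legendre (p : R) : 0 < p < 1 -> ellE p = RInt (Delta p) 0 (PI / 2).
Proof.
  intros Hp. unfold ellE.
  apply (RInt_gen_sin _ (fun z => sqrt (1 - p ^ 2 * z ^ 2))).
  - reflexivity.
  - intros t. now apply (continuous_Delta p t).
Qed.

(** * The amplitude *)

Lemma is_derive_ellF (p phi : R) : 0 < p < 1 ->
  is_derive (fun t => ellF t p) phi (/ Delta p phi).
Proof.
  intros Hp. apply (is_derive_primitive (fun t => / Delta p t) 0).
  intros y. now apply continuous_inv_Delta.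
Qed.

Lemma continuous_ellF (p phi : R) : 0 < p < 1 -> continuous (fun t => ellF t p) phi.
Proof.
  intros Hp. apply (is_derive_continuous _ _ _ (is_derive_ellF p phi Hp)).
Qed.

(** The mean value theorem for [ellF], solved for the increment of the
    amplitude: as [0 < Delta <= 1] it yields the injectivity and surjectivity of
    [ellF], and it gives the difference quotients of [am] exactly. *)
Lemma ellF_mean_value (p a b : R) : 0 < p < 1 ->
  exists c, Rmin a b <= c <= Rmax a b /\ b - a = Delta p c * (ellF b p - ellF a p).
Proof.
  intros Hp.
  destruct (MVT_gen (fun t => ellF t p) a b (fun t => / Delta p t)) as [c [Hc H]].
  - intros x _. now apply is_derive_ellF.
  - intros x _. now apply continuity_pt_filterlim, continuous_ellF.
  - exists c. split; [exact Hc|]. rewrite H. assert (H1 := Delta_pos p c Hp). field. lra.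
Qed.

Lemma ellF_expansive (p a b : R) : 0 < p < 1 ->
  Rabs (b - a) <= Rabs (ellF b p - ellF a p).
Proof.
  intros Hp. destruct (ellF_mean_value p a b Hp) as [c [_ ->]].
  assert (H1 := Delta_pos p c Hp). assert (H2 := Delta_le_1 p c Hp).
  rewrite Rabs_mult, (Rabs_right (Delta p c)) by lra.
  assert (H := Rabs_pos (ellF b p - ellF a p)). nra.
Qed.

Lemma am_ellF (p phi : R) : 0 < p < 1 -> am (ellF phi p) p = phi.
Proof.
  intros Hp. apply (iota_unique (V := R_CompleteNormedModule)); [|reflexivity].
  intros y Hy. assert (H := ellF_expansive p phi y Hp).
  rewrite Hy, Rminus_diag, Rabs_R0 in H.
  assert (H1 := Rabs_pos (y - phi)).
  destruct (Req_dec (y - phi) 0) as [H0|H0]; [lra|].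
  apply Rabs_pos_lt in H0. lra.
Qed.

(** [ellF] grows at least as fast as the identity, so it takes values on both
    sides of [x] at [- |x|] and [|x|]. *)
Lemma ellF_surjective (p x : R) : 0 < p < 1 -> exists phi, ellF phi p = x.
Proof.
  intros Hp.
  assert (H0 : ellF 0 p = 0) by apply (RInt_point (V := R_CompleteNormedModule)).
  assert (Hmono : forall a b, a <= b -> b - a <= ellF b p - ellF a p).
  { intros a b Hab. destruct (ellF_mean_value p a b Hp) as [c [_ H]].
    assert (H1 := Delta_pos p c Hp). assert (H2 := Delta_le_1 p c Hp).
    destruct (Rle_lt_dec 0 (ellF b p - ellF a p)); nra. }
  assert (Hx := Rabs_pos x).
  assert (Ha := Hmono (- Rabs x) 0 ltac:(lra)).
  assert (Hb := Hmono 0 (Rabs x) ltac:(lra)).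
  assert (Hx' := Rle_abs x). assert (Hx'' := Rabs_maj2 x).
  destruct (IVT_gen (fun t => ellF t p) (- Rabs x) (Rabs x) x) as [phi [_ H]].
  - intros t. now apply continuity_pt_filterlim, continuous_ellF.
  - rewrite Rmin_left, Rmax_right by lra. lra.
  - now exists phi.
Qed.

Lemma ellF_am (p x : R) : 0 < p < 1 -> ellF (am x p) p = x.
Proof.
  intros Hp. destruct (ellF_surjective p x Hp) as [phi <-]. now rewrite am_ellF.
Qed.

(** By [ellF_mean_value] the difference quotient of [am] over a step [h] is
    exactly [Delta p c] for some [c] within [|h|] of [am x p], because [am] is
    nonexpansive; continuity of [Delta] concludes. *)
Lemma is_derive_am (p x : R) : 0 < p < 1 ->
  is_derive (fun x => am x p) x (Delta p (am x p)).
Proof.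
  intros Hp. apply is_derive_Reals. intros eps Heps.
  destruct (continuous_Delta p (am x p) Hp
    (fun y => Rabs (y - Delta p (am x p)) < eps)) as [d Hd].
  { exists (mkposreal eps Heps). intros y Hy. exact Hy. }
  exists d. intros h Hh Hhd.
  destruct (ellF_mean_value p (am x p) (am (x + h) p) Hp) as [c [Hc H]].
  rewrite !ellF_am in H by easy.
  replace (x + h - x) with h in H by ring.
  rewrite H. replace (Delta p c * h / h) with (Delta p c) by now field.
  apply Hd. change (Rabs (c - am x p) < d).
  apply Rle_lt_trans with (2 := Hhd).
  apply Rle_trans with (Rabs (am (x + h) p - am x p)).
  - revert Hc. unfold Rmin, Rmax, Rabs.
    repeat destruct Rle_dec; repeat destruct Rcase_abs; lra.
  - rewrite H, Rabs_mult. assert (H1 := Delta_pos p c Hp).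
    assert (H2 := Delta_le_1 p c Hp). rewrite (Rabs_right (Delta p c)) by lra.
    assert (H3 := Rabs_pos h). nra.
Qed.

(** [1 / Delta] is even with period [PI], so advancing the amplitude by [PI]
    advances [ellF] by twice the quarter period [K]. *)
Lemma am_shift (p x : R) (m : nat) : 0 < p < 1 ->
  am (x + 2 * INR m * ellK p) p = am x p + INR m * PI.
Proof.
  intros Hp. rewrite <- (am_ellF p (am x p + INR m * PI)) by easy. f_equal.
  unfold ellF at 1.
  rewrite <- (RInt_add _ 0 (am x p)) by (intros y; now apply (continuous_inv_Delta p y)).
  rewrite (RInt_even_periods (fun t => / Delta p t)).
  - rewrite ellK_Legendre by easy. f_equal. symmetry. now apply ellF_am.
  - intros y; now apply continuous_inv_Delta.
  - intros y. now rewrite Delta_opp.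
  - intros y. now rewrite Delta_period.
Qed.

(** Equal to [(E - (1 - p^2) K) / p^2] in terms of the complete integrals, but
    monotonicity in [p] is visible on this form. *)
Definition ellJ (p : R) : R := RInt (fun t => cos t ^ 2 / Delta p t) 0 (PI / 2).

Lemma continuous_ellJ_integrand (p t : R) : 0 < p < 1 ->
  continuous (fun t => cos t ^ 2 / Delta p t) t.
Proof.
  intros Hp.
  apply (continuous_mult (K := R_AbsRing) (fun t => cos t ^ 2) (fun t => / Delta p t)).
  - apply (ex_derive_continuous (K := R_AbsRing) (V := R_NormedModule)). auto_derive. easy.
  - now apply continuous_inv_Delta.
Qed.

(** * The energy of a wavelike curve *)

Lemma is_derive_am_affine (p a c t : R) : 0 < p < 1 ->
  is_derive (fun t => am (a * t + c) p) t (a * Delta p (am (a * t + c) p)).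
Proof.
  intros Hp.
  apply (is_derive_comp (fun x => am x p) (fun t => a * t + c)).
  - now apply is_derive_am.
  - auto_derive; [easy|ring].
Qed.

(** Since [d phi / dt = a * Delta phi], the integral of [a * cos^2 phi dt] is
    that of [cos^2 / Delta] over a range of [m] periods.  The phase [c] drops
    out, which is what puts the two families on the same footing. *)
Lemma RInt_cn_sqr (p L c : R) (m : nat) : 0 < p < 1 ->
  let a := 2 * INR m * ellK p / L in
  0 < L -> 0 < ellK p ->
  a * RInt (fun t => cos (am (a * t + c) p) ^ 2) 0 L = 2 * INR m * ellJ p.
Proof.
  intros Hp a HL HK.
  assert (Hd := fun t => is_derive_am_affine p a c t Hp).
  assert (Hc : forall t, continuous (fun t => am (a * t + c) p) t).
  { intros t. apply (ex_derive_continuous (K := R_AbsRing) (V := R_NormedModule)).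
    eexists. apply Hd. }
  rewrite <- RInt_scal_R.
  2:{ intros t. apply (continuous_comp (fun t => am (a * t + c) p) (fun x => cos x ^ 2)).
      apply Hc. apply (ex_derive_continuous (K := R_AbsRing) (V := R_NormedModule)).
      auto_derive. easy. }
  transitivity (RInt (fun t => scal (a * Delta p (am (a * t + c) p))
     ((fun x => cos x ^ 2 / Delta p x) (am (a * t + c) p))) 0 L).
  { apply RInt_ext. intros t _. unfold scal; simpl; unfold mult; simpl.
    match goal with |- @eq _ ?u ?v => change (@eq R u v) end.
    field. apply Rgt_not_eq. now apply Delta_pos. }
  rewrite (RInt_comp (fun x => cos x ^ 2 / Delta p x) (fun t => am (a * t + c) p)).
  - replace (a * L + c) with (a * 0 + c + 2 * INR m * ellK p) by (unfold a; field; lra).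
    rewrite am_shift by easy.
    apply RInt_even_periods.
    + intros y; now apply continuous_ellJ_integrand.
    + intros y. now rewrite Delta_opp, cos_neg.
    + intros y. rewrite Delta_period, neg_cos. f_equal. ring.
  - intros t _. now apply continuous_ellJ_integrand.
  - intros t _. split; [apply Hd|].
    apply (continuous_mult (K := R_AbsRing) (fun _ => a) (fun t => Delta p (am (a * t + c) p))).
    + apply continuous_const.
    + apply (continuous_comp (fun t => am (a * t + c) p) (Delta p)); [apply Hc|].
      now apply continuous_Delta.
Qed.

(** The signs [s] and [t] account for the reflections relating the two families
    and the two branches; they disappear from the square of the curvature.
    With [phi' = a Delta phi] and [Delta^2 = 1 - p^2 sin^2 phi], both the unit
    speed and the curvature [s t * 2 p a cos phi] come from
    [(1 - 2 p^2 sin^2 phi)^2 + 4 p^2 sin^2 phi Delta^2 = 1]. *)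
Lemma wavelike_curvature (p a s t : R) (phi : R -> R) (gamma : R -> R * R) (x : R) :
  0 < p < 1 -> s ^ 2 = 1 -> t ^ 2 = 1 ->
  (forall u, is_derive phi u (a * Delta p (phi u))) ->
  (forall u, is_derive (fun v => fst (gamma v)) u (s * (1 - 2 * p ^ 2 * sin (phi u) ^ 2))) ->
  (forall u, is_derive (fun v => snd (gamma v)) u (t * (2 * p * sin (phi u) * Delta p (phi u)))) ->
  curvature gamma x ^ 2 * speed gamma x = 4 * p ^ 2 * a ^ 2 * cos (phi x) ^ 2.
Proof.
  intros Hp Hs Ht Hphi HX HY.
  assert (HX1 : forall u, Derive (fun v => fst (gamma v)) u
    = s * (1 - 2 * p ^ 2 * sin (phi u) ^ 2)) by (intros u; apply is_derive_unique, HX).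
  assert (HY1 : forall u, Derive (fun v => snd (gamma v)) u
    = t * (2 * p * sin (phi u) * Delta p (phi u))) by (intros u; apply is_derive_unique, HY).
  assert (HD := Delta_sqr p (phi x) Hp). assert (HD0 := Delta_pos p (phi x) Hp).
  assert (HX2 : Derive_n (fun v => fst (gamma v)) 2 x
    = s * (- 4 * p ^ 2 * a * sin (phi x) * cos (phi x) * Delta p (phi x))).
  { change (Derive (Derive (fun v => fst (gamma v))) x
      = s * (- 4 * p ^ 2 * a * sin (phi x) * cos (phi x) * Delta p (phi x))).
    rewrite (Derive_ext _ _ x HX1). apply is_derive_unique.
    replace (s * _) with (scal (a * Delta p (phi x))
      (s * (- 4 * p ^ 2 * sin (phi x) * cos (phi x)))).
    2:{ unfold scal; simpl; unfold mult; simpl. ring. }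
    apply (is_derive_comp (fun f => s * (1 - 2 * p ^ 2 * sin f ^ 2)) phi).
    - auto_derive; [easy|ring].
    - apply Hphi. }
  assert (HY2 : Derive_n (fun v => snd (gamma v)) 2 x
    = t * (2 * p * a * cos (phi x) * (1 - 2 * p ^ 2 * sin (phi x) ^ 2))).
  { change (Derive (Derive (fun v => snd (gamma v))) x
      = t * (2 * p * a * cos (phi x) * (1 - 2 * p ^ 2 * sin (phi x) ^ 2))).
    rewrite (Derive_ext _ _ x HY1). apply is_derive_unique.
    assert (HDd := is_derive_Delta p (phi x) Hp).
    replace (t * _) with (scal (a * Delta p (phi x))
      (t * (2 * p * (cos (phi x) * Delta p (phi x)
         + sin (phi x) * (- p ^ 2 * sin (phi x) * cos (phi x) / Delta p (phi x)))))).
    2:{ unfold scal; simpl; unfold mult; simpl.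
        transitivity (t * (2 * p * a * cos (phi x) * (Delta p (phi x) ^ 2 - p ^ 2 * sin (phi x) ^ 2))).
        field; lra. rewrite HD. ring. }
    apply (is_derive_comp (fun f => t * (2 * p * sin f * Delta p f)) phi).
    - auto_derive.
      + eexists. apply HDd.
      + replace (Derive (fun x0 : R => Delta p x0) (phi x)) with
          (- p ^ 2 * sin (phi x) * cos (phi x) / Delta p (phi x))
          by (symmetry; apply is_derive_unique, HDd).
        ring.
    - apply Hphi. }
  assert (Hspeed : speed gamma x = 1).
  { unfold speed. rewrite HX1, HY1.
    transitivity (sqrt 1); [f_equal|apply sqrt_1].
    transitivity (s ^ 2 * (1 - 2 * p ^ 2 * sin (phi x) ^ 2) ^ 2
      + t ^ 2 * (4 * p ^ 2 * sin (phi x) ^ 2 * Delta p (phi x) ^ 2)); [ring|].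
    rewrite Hs, Ht, HD. ring. }
  unfold curvature. rewrite Hspeed, HX1, HY1, HX2, HY2.
  transitivity (s ^ 2 * t ^ 2 * (2 * p * a * cos (phi x)) ^ 2 *
    ((1 - 2 * p ^ 2 * sin (phi x) ^ 2) ^ 2
      + 4 * p ^ 2 * sin (phi x) ^ 2 * Delta p (phi x) ^ 2) ^ 2).
  - field.
  - rewrite Hs, Ht, HD. ring.
Qed.

Lemma ellK_pos (p : R) : 0 < p < 1 -> 0 < ellK p.
Proof.
  intros Hp. rewrite ellK_Legendre by easy. assert (HPI := PI_RGT_0).
  apply RInt_gt_0; [lra| |].
  - intros x _. apply Rinv_0_lt_compat. now apply (Delta_pos p x).
  - intros x _. now apply (continuous_inv_Delta p x).
Qed.

Lemma ellJ_pos (p : R) : 0 < p < 1 -> 0 < ellJ p.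
Proof.
  intros Hp. assert (HPI := PI_RGT_0).
  apply RInt_gt_0; [lra| |].
  - intros x Hx. apply Rdiv_lt_0_compat; [|now apply Delta_pos].
    apply pow_lt, cos_gt_0; lra.
  - intros x _. now apply continuous_ellJ_integrand.
Qed.

(** The check curves differ from the hat ones by a sign in each coordinate and
    by the phase, [- K] instead of [K]; neither affects the energy. *)
Lemma wavelike_energy (p L c s t : R) (n : nat) (gamma : R -> R * R) :
  0 < p < 1 -> 0 < L -> s ^ 2 = 1 -> t ^ 2 = 1 ->
  let a := 2 * (INR n + 1) * ellK p / L in
  (forall u, fst (gamma u)
     = s * (2 * p ^ 2 * RInt (fun v => cn (a * v + c) p ^ 2) 0 u + (1 - 2 * p ^ 2) * u)) ->
  (forall u, snd (gamma u)
     = - t * (p * L / ((INR n + 1) * ellK p)) * cn (a * u + c) p) ->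
  elastic_energy gamma 0 L
  = (INR n + 1) ^ 2 * (16 * p ^ 2 * ellK p * ellJ p / L).
Proof.
  intros Hp HL Hs Ht a HX HY.
  assert (HK := ellK_pos p Hp). assert (Hn := pos_INR n).
  assert (Ha : 0 < a) by (apply Rdiv_lt_0_compat; [nra|easy]).
  assert (Hd := fun u => is_derive_am_affine p a c u Hp).
  assert (Hcn : forall u, is_derive (fun v => cn (a * v + c) p) u
    (- a * sin (am (a * u + c) p) * Delta p (am (a * u + c) p))).
  { intros u. unfold cn.
    replace (- a * _ * _) with (scal (a * Delta p (am (a * u + c) p)) (- sin (am (a * u + c) p))).
    2:{ unfold scal; simpl; unfold mult; simpl. ring. }
    apply (is_derive_comp cos (fun v => am (a * v + c) p)); [|apply Hd].
    auto_derive; [easy|ring]. }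
  assert (Hcn2 : forall u, continuous (fun v => cn (a * v + c) p ^ 2) u).
  { intros u. apply (ex_derive_continuous (K := R_AbsRing) (V := R_NormedModule)).
    apply ex_derive_pow. eexists. apply Hcn. }
  unfold elastic_energy.
  transitivity (RInt (fun v => 4 * p ^ 2 * a ^ 2 * cos (am (a * v + c) p) ^ 2) 0 L).
  { apply RInt_ext. intros v _.
    apply (wavelike_curvature p a s t (fun v => am (a * v + c) p)); try easy.
    - intros u. apply (is_derive_ext (fun u =>
        s * (2 * p ^ 2 * RInt (fun v => cn (a * v + c) p ^ 2) 0 u + (1 - 2 * p ^ 2) * u))).
      { intros w. now rewrite HX. }
      assert (HI := is_derive_primitive (fun v => cn (a * v + c) p ^ 2) 0 u Hcn2).
      replace (s * (1 - _)) with (s * (2 * p ^ 2 * cn (a * u + c) p ^ 2 + (1 - 2 * p ^ 2))).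
      + apply is_derive_scal.
        apply (is_derive_plus (K := R_AbsRing) (V := R_NormedModule)).
        * now apply (is_derive_scal (fun u => RInt (fun v => cn (a * v + c) p ^ 2) 0 u)).
        * auto_derive; [easy|ring].
      + unfold cn.
        assert (H := sin2_cos2 (am (a * u + c) p)). unfold Rsqr in H.
        replace (cos (am (a * u + c) p) ^ 2) with (1 - sin (am (a * u + c) p) ^ 2) by (simpl; lra).
        ring.
    - intros u. apply (is_derive_ext (fun u =>
        - t * (p * L / ((INR n + 1) * ellK p)) * cn (a * u + c) p)).
      { intros w. now rewrite HY. }
      replace (t * _) with (- t * (p * L / ((INR n + 1) * ellK p)) *
        (- a * sin (am (a * u + c) p) * Delta p (am (a * u + c) p))).
      2:{ unfold a at 1. field. lra. }
      apply (is_derive_scal (fun u => cn (a * u + c) p)). apply Hcn. }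
  rewrite RInt_scal_R by exact Hcn2.
  (* On [[0, L]] the amplitude covers [n + 1] half turns. *)
  assert (H := RInt_cn_sqr p L c (S n) Hp). rewrite S_INR in H.
  specialize (H HL HK). fold a in H.
  replace (4 * p ^ 2 * a ^ 2 * RInt (fun v => cos (am (a * v + c) p) ^ 2) 0 L)
    with (4 * p ^ 2 * a * (a * RInt (fun v => cos (am (a * v + c) p) ^ 2) 0 L)) by ring.
  rewrite H. unfold a. field. lra.
Qed.

Lemma gamma_hat_energy (p L : R) (n : nat) (e : branch) : 0 < p < 1 -> 0 < L ->
  elastic_energy (gamma_hat L p n e) 0 L
  = (INR n + 1) ^ 2 * (16 * p ^ 2 * ellK p * ellJ p / L).
Proof.
  intros Hp HL. apply (wavelike_energy p L (ellK p) 1 (sgn e)); try easy.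
  - ring.
  - destruct e; simpl; ring.
  - intros u. unfold gamma_hat, fst, snd, hatX. ring.
  - intros u. unfold gamma_hat, fst, snd, hatY. ring.
Qed.

Lemma gamma_check_energy (p L : R) (n : nat) (e : branch) : 0 < p < 1 -> 0 < L ->
  elastic_energy (gamma_check L p n e) 0 L
  = (INR n + 1) ^ 2 * (16 * p ^ 2 * ellK p * ellJ p / L).
Proof.
  intros Hp HL. apply (wavelike_energy p L (- ellK p) (-1) (- sgn e)); try easy.
  - ring.
  - destruct e; simpl; ring.
  - intros u. unfold gamma_check, fst, snd, checkX, Rminus. ring.
  - intros u. unfold gamma_check, fst, snd, checkY, Rminus. ring.
Qed.

(** * Monotonicity in the modulus *)

Lemma inv_Delta_increasing (p q t : R) : 0 < p <= q -> q < 1 -> / Delta p t <= / Delta q t.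
Proof.
  intros Hp Hq. apply Rinv_le_contravar; [apply Delta_pos; lra|].
  now apply Delta_decreasing.
Qed.

Lemma ellK_increasing (p q : R) : 0 < p <= q -> q < 1 -> ellK p <= ellK q.
Proof.
  intros Hp Hq. assert (HPI := PI_RGT_0). rewrite !ellK_Legendre by lra.
  apply RInt_le; try lra.
  1,2: apply continuous_ex_RInt; intros x; apply (continuous_inv_Delta _ x); lra.
  intros x _. now apply (inv_Delta_increasing p q x).
Qed.

Lemma ellE_decreasing (p q : R) : 0 < p <= q -> q < 1 -> ellE q <= ellE p.
Proof.
  intros Hp Hq. assert (HPI := PI_RGT_0). rewrite !ellE_Legendre by lra.
  apply RInt_le; try lra.
  1,2: apply continuous_ex_RInt; intros x; apply (continuous_Delta _ x); lra.
  intros x _. now apply Delta_decreasing.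
Qed.

Lemma ellJ_increasing (p q : R) : 0 < p <= q -> q < 1 -> ellJ p <= ellJ q.
Proof.
  intros Hp Hq. assert (HPI := PI_RGT_0).
  apply RInt_le; try lra.
  1,2: apply continuous_ex_RInt; intros x; apply (continuous_ellJ_integrand _ x); lra.
  intros x _. apply Rmult_le_compat_l; [apply pow2_ge_0|].
  now apply (inv_Delta_increasing p q x).
Qed.

Lemma ellE_div_ellK_decreasing (p q : R) : 0 < p <= q -> q < 1 ->
  ellE q / ellK q <= ellE p / ellK p.
Proof.
  intros Hp Hq.
  assert (HE : 0 <= ellE q).
  { rewrite ellE_Legendre by lra. assert (HPI := PI_RGT_0).
    apply RInt_ge_0; [lra| |].
    - apply continuous_ex_RInt. intros x. apply continuous_Delta. lra.
    - intros x _. apply Rlt_le, Delta_pos. lra. }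
  apply Rmult_le_compat.
  - easy.
  - apply Rlt_le, Rinv_0_lt_compat, ellK_pos. lra.
  - now apply ellE_decreasing.
  - apply Rinv_le_contravar; [apply ellK_pos; lra|]. now apply ellK_increasing.
Qed.

Theorem theorem1p2 (l L : R) (hl : 0 < l) (hlL : l < L)
  (p_hat : R) (hp_hat : 0 < p_hat < 1)
  (hp_hat_eq : 2 * (ellE p_hat / ellK p_hat) - 1 = l / L)
  (p_check : R) (hp_check : 0 < p_check < 1)
  (hp_check_eq : -2 * (ellE p_check / ellK p_check) + 1 = l / L)
  (n : nat) :
  (forall e : branch,
     elastic_energy (gamma_hat L p_hat n e) 0 L
     = (INR n + 1) ^ 2 * elastic_energy (gamma_hat L p_hat 0 Plus) 0 L) /\
  (forall e : branch,
     elastic_energy (gamma_check L p_check n e) 0 L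
     = (INR n + 1) ^ 2 * elastic_energy (gamma_check L p_check 0 Plus) 0 L) /\
  elastic_energy (gamma_hat L p_hat n Plus) 0 L
    < elastic_energy (gamma_check L p_check n Plus) 0 L.
Proof.
  assert (HL : 0 < L) by lra.
  split; [|split].
  - intros e. rewrite !gamma_hat_energy by easy. simpl INR. ring.
  - intros e. rewrite !gamma_check_energy by easy. simpl INR. ring.
  - rewrite gamma_hat_energy, gamma_check_energy by easy.
    assert (Hr : 0 < l / L) by (apply Rdiv_lt_0_compat; easy).
    (* Otherwise [E / K] would be at least as large at [p_check] as at [p_hat],
       that is, [1 - l / L >= 1 + l / L]. *)
    assert (Hlt : p_hat < p_check).
    { apply Rnot_le_lt. intros Hle.
      assert (H := ellE_div_ellK_decreasing p_check p_hat ltac:(lra) ltac:(lra)). lra. }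
    assert (HKp := ellK_pos p_hat hp_hat). assert (HJp := ellJ_pos p_hat hp_hat).
    assert (HK := ellK_increasing p_hat p_check ltac:(lra) ltac:(lra)).
    assert (HJ := ellJ_increasing p_hat p_check ltac:(lra) ltac:(lra)).
    assert (Hp2 : p_hat ^ 2 < p_check ^ 2) by nra.
    apply Rmult_lt_compat_l; [apply pow_lt; assert (Hn := pos_INR n); lra|].
    apply Rmult_lt_compat_r; [now apply Rinv_0_lt_compat|].
    apply Rlt_le_trans with (16 * p_check ^ 2 * ellK p_hat * ellJ p_hat).
    + repeat (apply Rmult_lt_compat_r; [easy|]). lra.
    + apply Rmult_le_compat; try easy; [|lra|].
      * assert (H := pow2_ge_0 p_check). apply Rmult_le_pos; lra.
      * apply Rmult_le_compat_l; [|easy]. assert (H := pow2_ge_0 p_check). lra.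
Qed.
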